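(* The interpretability logic $\mathsf{ILM}$ is complete for finite tree conversely well-founded provability models (for the language $\mathcal L_\rhd$) with necessitation: if $A\in\mathcal L_\rhd$ holds at every world of every such model, then $\mathsf{ILM}\vdash A$.
   Context: Language $\mathcal L_\rhd$: formulas built from atomic propositions and $\bot$ using $\to$ and a binary modal operator $\rhd$; $\neg A:=A\to\bot$, other Boolean connectives defined classically, $\Box A:=\neg A\rhd\bot$, $\Diamond A:=\neg\Box\neg A$. A formula is purely modal if it is a Boolean combination of formulas $B\rhd C$. $\mathsf{ILM}$ is the logic in $\mathcal L_\rhd$ whose only rule is modus ponens and whose axioms are: all theorems of $\mathsf{GL}$ ($\mathsf K$ plus $\Box A\to\Box\Box A$ and $\Box(\Box A\to A)\to\Box A$, over $\mathcal L_\rhd$); $\Box(A\to B)\to A\rhd B$; $(A\rhd B\wedge B\rhd C)\to A\rhd C$; $(B\rhd A\wedge C\rhd A)\to(B\vee C)\rhd A$; $\Diamond A\rhd A$; $A\rhd B\to((\Box C\wedge A)\rhd(\Box C\wedge B))$; and $\Box X$ for $X$ any instance of the previous five schemes. A theory is a pair of a set of axioms and a set of inference rules over $\mathcal L_\rhd$; $\mathsf T\vdash A$ means derivability. A theory is classical if modus ponens is one of its rules and all classical tautologies are derivable. A provability pre-model is $\mathcal P=(W,\sqsubset,\{L_w\}_{w\in W^\sqsubset},V)$ with $W$ nonempty, $\sqsubset$ a binary relation on $W$, $V\subseteq W\times\mathrm{atoms}$, $W^\sqsubset=\{u:\exists v\,(v\sqsubset u)\}$, and a theory $L_w$ for each $w\in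 W^\sqsubset$. Satisfaction: atoms via $V$, $\bot$ never holds, $\to$ classical, $\mathcal P,w\Vdash A\rhd B$ iff for every $u$ with $w\sqsubset u$ and every formula $E$, $L_u\vdash B\to\Diamond E$ implies $L_u\vdash A\to\Diamond E$. With $\sqsubset^+$ the transitive closure, $\mathcal P,w\Vdash^+A$ iff there is $u\sqsubset w$ with $\mathcal P,v\Vdash A$ for all $v$ with $u\sqsubset^+v$. A provability model is a pre-model in which every $L_w$ is classical and modal completeness holds: for every $w\in W^\sqsubset$ and purely modal $A$, $\mathcal P,w\Vdash^+A$ implies $L_w\vdash A$. Necessitation: every $L_w$ has (or is closed under) the rule ''from $A$ infer $\Box A$''. Tree: whenever $w\sqsubset v$ and $u\sqsubset v$, either $w=u$, $w\sqsubset^+u$ or $u\sqsubset^+w$. Conversely well-founded: no infinite chain $w_0\sqsubset w_1\sqsubset\cdots$. *)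

(* Defs.v *)
From Stdlib Require Import List Relations FinFun.
Import ListNotations.

Inductive form : Type :=
| Var (p : nat)
| Bot
| Imp (A B : form)
| Rhd (A B : form).

Declare Scope form_scope.
Delimit Scope form_scope with form.
Bind Scope form_scope with form.
Notation "A --> B" := (Imp A B) (at level 55, right associativity) : form_scope.
Notation "A |> B" := (Rhd A B) (at level 45, no associativity) : form_scope.
Local Open Scope form_scope.

Definition Neg (A : form) : form := A --> Bot.
Definition And (A B : form) : form := Neg (A --> Neg B).
Definition Or (A B : form) : form := Neg A --> B.
Definition Box (A : form) : form := Neg A |> Bot.
Definition Dia (A : form) : form := Neg (Box (Neg A)).

Fixpoint purely_modal (A : form) : Prop :=
  match A with
  | Var _ => False
  | Bot => True
  | B --> C => purely_modal B /\ purely_modal C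
  | _ |> _ => True
  end.

(* Formulas [B |> C] are treated as propositional atoms. *)
Fixpoint eval (v : form -> bool) (A : form) : bool :=
  match A with
  | Bot => false
  | B --> C => implb (eval v B) (eval v C)
  | _ => v A
  end.

Definition tautology (A : form) : Prop := forall v, eval v A = true.

(* An inference rule is identified with the set of its instances
   (premises, conclusion). *)
Definition rule : Type := list form -> form -> Prop.

Record theory : Type := Theory {
  axioms : form -> Prop;
  rules : rule -> Prop
}.

Inductive derives (T : theory) : form -> Prop :=
| derives_axiom A : axioms T A -> derives T A
| derives_rule (r : rule) ps A :
    rules T r -> r ps A -> (forall B, In B ps -> derives T B) -> derives T A.

Definition closed_under (T : theory) (r : rule) : Prop :=
  forall ps A, r ps A -> (forall B, In B ps -> derives T B) -> derives T A.

Inductive modus_ponens : rule :=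
| modus_ponens_intro A B : modus_ponens [A --> B; A] B.

Inductive necessitation : rule :=
| necessitation_intro A : necessitation [A] (Box A).

Definition classical (T : theory) : Prop :=
  rules T modus_ponens /\ forall A, tautology A -> derives T A.

Inductive GL_axiom : form -> Prop :=
| GL_taut A : tautology A -> GL_axiom A
| GL_K A B : GL_axiom (Box (A --> B) --> Box A --> Box B)
| GL_4 A : GL_axiom (Box A --> Box (Box A))
| GL_Lob A : GL_axiom (Box (Box A --> A) --> Box A).

Definition GL : theory :=
  Theory GL_axiom (fun r => r = modus_ponens \/ r = necessitation).

Inductive ILM_scheme : form -> Prop :=
| ILM_J1 A B : ILM_scheme (Box (A --> B) --> A |> B)
| ILM_J2 A B C : ILM_scheme (And (A |> B) (B |> C) --> A |> C)
| ILM_J3 A B C : ILM_scheme (And (B |> A) (C |> A) --> Or B C |> A)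
| ILM_J5 A : ILM_scheme (Dia A |> A)
| ILM_M A B C : ILM_scheme (A |> B --> And (Box C) A |> And (Box C) B).

Inductive ILM_axiom : form -> Prop :=
| ILM_GL A : derives GL A -> ILM_axiom A
| ILM_inst A : ILM_scheme A -> ILM_axiom A
| ILM_box A : ILM_scheme A -> ILM_axiom (Box A).

Definition ILM : theory := Theory ILM_axiom (fun r => r = modus_ponens).

(* [thy] is total for convenience: its value at a world without a
   predecessor (see [has_pred]) is never used below. *)
Record premodel : Type := Premodel {
  world : Type;
  world_nonempty : inhabited world;
  acc : world -> world -> Prop;
  thy : world -> theory;
  val : world -> nat -> Prop
}.

Definition has_pred (P : premodel) (u : world P) : Prop :=
  exists v, acc P v u.

Definition acc_plus (P : premodel) : world P -> world P -> Prop :=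
  clos_trans (world P) (acc P).

Fixpoint sat (P : premodel) (w : world P) (A : form) : Prop :=
  match A with
  | Var p => val P w p
  | Bot => False
  | B --> C => sat P w B -> sat P w C
  | B |> C =>
      forall u, acc P w u -> forall E,
        derives (thy P u) (C --> Dia E) -> derives (thy P u) (B --> Dia E)
  end.

Definition sat_plus (P : premodel) (w : world P) (A : form) : Prop :=
  exists u, acc P u w /\ forall v, acc_plus P u v -> sat P v A.

Definition modally_complete (P : premodel) : Prop :=
  forall w, has_pred P w ->
  forall A, purely_modal A -> sat_plus P w A -> derives (thy P w) A.

Definition provability_model (P : premodel) : Prop :=
  (forall w, has_pred P w -> classical (thy P w)) /\ modally_complete P.

Definition with_necessitation (P : premodel) : Prop :=
  forall w, has_pred P w ->
  rules (thy P w) necessitation \/ closed_under (thy P w) necessitation.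

Definition finite_model (P : premodel) : Prop := Finite (world P).

Definition tree (P : premodel) : Prop :=
  forall w u v : world P, acc P w v -> acc P u v ->
  w = u \/ acc_plus P w u \/ acc_plus P u w.

Definition conversely_well_founded (P : premodel) : Prop :=
  ~ exists f : nat -> world P, forall n, acc P (f n) (f (S n)).

(* Main.v *)
(** Suppose [A] is not derivable in ILM.  A node of the countermodel is a pair
    [(k, t)] of a rank [k] and a consistent conjunction [t] deciding all formulas
    of a finite set [closure A k], such that at most [k] boxes of [closure A 0]
    fail to follow from [t].  The set at rank [k + 1] contains [t |> E] and
    [Box (Neg t)] for every type [t] at rank [k] and every [E] that is [Bot] or
    a right-hand side of a [|>]-subformula of [A].  A node [v] of lower rank is
    [E]-critical for [u] if [u] does not prove [v |> E]: by J5 the [E]-critical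
    nodes are closed under accessibility, by J3 and Loeb's axiom a refuted
    [B |> C] has a [C]-critical [B]-node with strictly more boxes, and by M a
    true [B |> C] leads from any [E]-critical [B]-node to an [E]-critical
    [C]-node of the same rank that sees no new nodes.

    The worlds of the provability model are the paths in this frame, which makes
    it a tree; a step from [w] to [x] labelled [E] carries the theory of all
    [E]-critical nodes of [w] that see no more than [x] does.  Distinct labels
    give distinct theories to the children of one world, which is essential: with
    one theory per world, worlds seeing the same nodes would agree on all [|>]. *)

Require Import Defs.
From Stdlib Require Import List Relations FinFun PeanoNat Lia Classical ClassicalEpsilon ProofIrrelevance.
Import ListNotations.
Local Open Scope form_scope.

(** * Derivations in ILM *)

Notation "|-- A" := (derives ILM A) (at level 70).

Ltac prove_tautology :=
  intros v; cbn;
  repeat match goal with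
  | |- context [eval v ?X] => destruct (eval v X)
  | |- context [v ?X] => destruct (v X)
  end; reflexivity.

Lemma ILM_mp A B : |-- A --> B -> |-- A -> |-- B.
Proof.
  intros hAB hA; apply derives_rule with (r := modus_ponens) (ps := [A --> B; A]).
  - reflexivity.
  - constructor.
  - intros C [<- | [<- | []]]; assumption.
Qed.

Lemma GL_axiom_ILM A : GL_axiom A -> |-- A.
Proof. intros h; apply derives_axiom, ILM_GL, derives_axiom, h. Qed.

Lemma ILM_scheme_derivable A : ILM_scheme A -> |-- A.
Proof. intros h; apply derives_axiom, ILM_inst, h. Qed.

Lemma ILM_taut A : tautology A -> |-- A.
Proof. intros h; apply GL_axiom_ILM, GL_taut, h. Qed.

Lemma ILM_taut1 A B : |-- A -> tautology (A --> B) -> |-- B.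
Proof. intros hA h; exact (ILM_mp _ _ (ILM_taut _ h) hA). Qed.

Lemma ILM_taut2 A B C :
  |-- A -> |-- B -> tautology (A --> B --> C) -> |-- C.
Proof. intros hA hB h; exact (ILM_mp _ _ (ILM_taut1 _ _ hA h) hB). Qed.

Lemma ILM_taut3 A B C D :
  |-- A -> |-- B -> |-- C -> tautology (A --> B --> C --> D) -> |-- D.
Proof. intros hA hB hC h; exact (ILM_mp _ _ (ILM_taut2 _ _ _ hA hB h) hC). Qed.

(** Necessitation is admissible although it is not a rule: theorems of GL admit it, the schemes come
    with their boxed instances, GL's axiom 4 boxes those once more, and K carries boxes through
    modus ponens. *)
Lemma ILM_nec A : |-- A -> |-- Box A.
Proof.
  induction 1 as [_ [A hA | A hA | A hA] | r ps A -> hr _ IH].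
  - apply derives_axiom, ILM_GL.
    apply derives_rule with (r := necessitation) (ps := [A]).
    + right; reflexivity.
    + constructor.
    + intros B [<- | []]; exact hA.
  - apply derives_axiom, ILM_box, hA.
  - apply (ILM_mp (Box A)).
    + apply GL_axiom_ILM, GL_4.
    + apply derives_axiom, ILM_box, hA.
  - destruct hr as [A B].
    apply (ILM_mp (Box A)); [apply (ILM_mp (Box (A --> B))) |].
    + apply GL_axiom_ILM, GL_K.
    + apply IH; now left.
    + apply IH; right; now left.
Qed.

Lemma box_mono A B : |-- A --> B -> |-- Box A --> Box B.
Proof.
  intros h; apply (ILM_mp (Box (A --> B))).
  - apply GL_axiom_ILM, GL_K.
  - apply ILM_nec, h.
Qed.

Lemma box_rhd A B : |-- Box (A --> B) --> A |> B.
Proof. apply ILM_scheme_derivable, ILM_J1. Qed.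

Lemma rhd_imp A B : |-- A --> B -> |-- A |> B.
Proof. intros h; apply (ILM_mp _ _ (box_rhd A B)), ILM_nec, h. Qed.

Lemma rhd_trans T A B C :
  |-- T --> A |> B -> |-- T --> B |> C -> |-- T --> A |> C.
Proof.
  intros h1 h2.
  refine (ILM_taut3 _ _ _ _ h1 h2 (ILM_scheme_derivable _ (ILM_J2 A B C)) _).
  prove_tautology.
Qed.

Lemma rhd_imp_under T A B : |-- A --> B -> |-- T --> A |> B.
Proof. intros h; refine (ILM_taut1 _ _ (rhd_imp _ _ h) _); prove_tautology. Qed.

Lemma rhd_or T A B C :
  |-- T --> A |> C -> |-- T --> B |> C -> |-- T --> Or A B |> C.
Proof.
  intros h1 h2.
  refine (ILM_taut3 _ _ _ _ h1 h2 (ILM_scheme_derivable _ (ILM_J3 C A B)) _).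
  prove_tautology.
Qed.

Lemma rhd_split T A F C :
  |-- T --> And A F |> C -> |-- T --> And A (Neg F) |> C -> |-- T --> A |> C.
Proof.
  intros h1 h2.
  apply rhd_trans with (Or (And A F) (And A (Neg F))).
  - apply rhd_imp_under, ILM_taut; prove_tautology.
  - now apply rhd_or.
Qed.

Lemma dia_rhd T A : |-- T --> Dia A |> A.
Proof.
  refine (ILM_taut1 _ _ (ILM_scheme_derivable _ (ILM_J5 A)) _).
  prove_tautology.
Qed.

Lemma rhd_bot_box T A : |-- T --> A |> Bot -> |-- T --> Box (Neg A).
Proof.
  intros h; apply rhd_trans with A; [| exact h].
  apply rhd_imp_under, ILM_taut; prove_tautology.
Qed.

Lemma box_neg_rhd T A C : |-- T --> Box (Neg A) -> |-- T --> A |> C.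
Proof.
  intros h.
  refine (ILM_taut3 _ _ _ _ h (box_mono (Neg A) (A --> C) _) (box_rhd A C) _).
  - apply ILM_taut; prove_tautology.
  - prove_tautology.
Qed.

(** With [H] the right-hand side, Loeb's axiom for [Neg A] shows that [A] implies [Dia H] or [H];
    the first disjunct is handled by J5, and J3 joins the two. *)
Lemma rhd_lob T A : |-- T --> A |> And A (Box (Neg A)).
Proof.
  set (H := And A (Box (Neg A))).
  assert (h : |-- Box (Neg H) --> Box (Neg A)).
  { refine (ILM_taut2 _ _ _
      (box_mono (Neg H) (Box (Neg A) --> Neg A) _)
      (GL_axiom_ILM _ (GL_Lob (Neg A))) _).
    - apply ILM_taut; prove_tautology.
    - prove_tautology. }
  apply rhd_trans with (Or (Dia H) H).
  - apply rhd_imp_under; refine (ILM_taut1 _ _ h _); prove_tautology.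
  - apply rhd_or.
    + apply dia_rhd.
    + apply rhd_imp_under, ILM_taut; prove_tautology.
Qed.

Fixpoint conjunction (l : list form) : form :=
  match l with
  | [] => Neg Bot
  | F :: l => And F (conjunction l)
  end.

Lemma conj_intro T l : (forall F, In F l -> |-- T --> F) -> |-- T --> conjunction l.
Proof.
  induction l as [| F l IH]; cbn; intros h.
  - apply ILM_taut; prove_tautology.
  - refine (ILM_taut2 _ _ _ (h F (or_introl eq_refl)) (IH _) _).
    + intros G hG; apply h; now right.
    + prove_tautology.
Qed.

Lemma conj_elim l F : In F l -> |-- conjunction l --> F.
Proof.
  induction l as [| G l IH]; cbn; [easy | intros [-> | h]].
  - apply ILM_taut; prove_tautology.
  - refine (ILM_taut1 _ _ (IH h) _); prove_tautology.
Qed.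

Lemma rhd_boxes T l A B :
  |-- T --> A |> B ->
  |-- T --> And (conjunction (map Box l)) A |> And (conjunction (map Box l)) B.
Proof.
  intros h; induction l as [| c l IH]; cbn.
  - apply rhd_trans with A; [| apply rhd_trans with B; [exact h |]];
      apply rhd_imp_under, ILM_taut; prove_tautology.
  - set (K := conjunction (map Box l)) in *.
    apply rhd_trans with (And (Box c) (And K A)).
    { apply rhd_imp_under, ILM_taut; prove_tautology. }
    apply rhd_trans with (And (Box c) (And K B)).
    + refine (ILM_taut2 _ _ _ IH
        (ILM_scheme_derivable _ (ILM_M (And K A) (And K B) c)) _).
      prove_tautology.
    + apply rhd_imp_under, ILM_taut; prove_tautology.
Qed.

(** * Frames and the provability models of their paths *)

(* A Veltman frame for ILM, except that [ext w i] plays the role of the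
   relation S_w separately for each label [i]; [ext w i x x] says that [x] is
   in its field, and the accessibility relation is the union of the fields. *)
Record frame : Type := Frame {
  node : Type;
  label : Type;
  ext : node -> label -> node -> node -> Prop;
  rel : node -> node -> Prop := fun w x => exists i, ext w i x x;
  atom : node -> nat -> Prop;
  rank : node -> nat;
  points : nat -> list (label * node);
  ext_refl_l : forall w i x y, ext w i x y -> ext w i x x;
  ext_refl_r : forall w i x y, ext w i x y -> ext w i y y;
  ext_trans : forall w i x y z, ext w i x y -> ext w i y z -> ext w i x z;
  ext_rel : forall w i x y z, ext w i x y -> rel y z -> ext w i x z;
  ext_M : forall w i x y z, ext w i x y -> rel y z -> rel x z;
  rel_rank : forall w x, rel w x -> rank x < rank w;
  ext_points : forall n w i x, rank w <= n -> ext w i x x -> In (i, x) (points n)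
}.

Fixpoint force (F : frame) (w : node F) (A : form) : Prop :=
  match A with
  | Var p => atom F w p
  | Bot => False
  | B --> C => force F w B -> force F w C
  | B |> C => forall i x, ext F w i x x -> force F x B ->
      exists y, ext F w i x y /\ force F y C
  end.

Lemma force_tautology F w A : tautology A -> force F w A.
Proof.
  intros h.
  set (v := fun B => if excluded_middle_informative (force F w B) then true else false).
  assert (hv : forall B, v B = true <-> force F w B).
  { intros B; unfold v; destruct excluded_middle_informative; intuition congruence. }
  assert (e : forall B, eval v B = true <-> force F w B).
  { induction B as [p | | B IHB C IHC | B _ C _]; try apply hv.
    - cbn; intuition congruence.
    - cbn; rewrite <- IHB, <- IHC.
      destruct (eval v B), (eval v C); cbn; intuition congruence. }
  apply e, h.
Qed.

Lemma force_Dia F w A :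
  force F w (Dia A) <-> exists x, rel F w x /\ force F x A.
Proof.
  cbn; split.
  - intros h; apply NNPP; intros hn; apply h; intros i x hx hA.
    exfalso; apply hA; intros a; apply hn; exists x; split; [now exists i | exact a].
  - intros (x & (i & hx) & a) h.
    destruct (h i x hx) as (_ & _ & []); intros h'; exact (h' a).
Qed.

Lemma force_Box F w A :
  (forall x, rel F w x -> force F x A) -> force F w (Box A).
Proof.
  intros h i x hx hA; exfalso; apply hA, h; now exists i.
Qed.

(** * Theories of sets of nodes and path models *)

Definition theory_of (F : frame) (X : node F -> Prop) : theory :=
  Theory (fun A => forall y, X y -> force F y A)
         (fun r => r = modus_ponens \/ r = necessitation).

(** The axioms are already closed under both rules: modus ponens is sound node by node, and
    necessitation because [X] is closed under [rel]. *)
Lemma derives_theory_of F X A :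
  (forall y z, X y -> rel F y z -> X z) ->
  derives (theory_of F X) A <-> forall y, X y -> force F y A.
Proof.
  intros up; split; [| apply (derives_axiom (theory_of F X))].
  induction 1 as [A hA | r ps A hr hps _ IH]; [exact hA |].
  destruct hr as [-> | ->]; [destruct hps as [A B] | destruct hps as [A]];
    cbn in IH; intros y hy.
  - apply (IH (A --> B)), (IH A); auto.
  - apply force_Box; intros x hx; apply (IH A); eauto.
Qed.

(* Paths grow at their head. *)
Definition path (F : frame) : Type := list (label F * node F).

Definition path_end (F : frame) (r : node F) (p : path F) : node F :=
  match p with [] => r | (_, x) :: _ => x end.

Fixpoint is_path (F : frame) (r : node F) (p : path F) : Prop :=
  match p with
  | [] => True
  | (i, x) :: p => ext F (path_end F r p) i x x /\ is_path F r p
  end.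

Definition path_model (F : frame) (r : node F) : premodel := {|
  world := {p | is_path F r p};
  world_nonempty := inhabits (exist (is_path F r) [] I);
  acc p q := exists e, proj1_sig q = e :: proj1_sig p;
  thy q := match proj1_sig q with
           | [] => theory_of F (fun _ => True)
           | (i, x) :: p => theory_of F (ext F (path_end F r p) i x)
           end;
  val p := atom F (path_end F r (proj1_sig p))
|}.

Lemma derives_step F r i x p h A :
  derives (thy (path_model F r) (exist _ ((i, x) :: p) h)) A <->
  forall y, ext F (path_end F r p) i x y -> force F y A.
Proof. apply derives_theory_of; intros y z; apply ext_rel. Qed.

Lemma sat_force F r A (p : world (path_model F r)) :
  sat (path_model F r) p A <-> force F (path_end F r (proj1_sig p)) A.
Proof.
  destruct p as [p hp]; cbn [proj1_sig].
  induction A as [n | | B IHB C IHC | B _ C _].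
  - reflexivity.
  - reflexivity.
  - cbn [sat force]; rewrite IHB, IHC; reflexivity.
  - split.
    + intros h i x hx hB.
      assert (hq : is_path F r ((i, x) :: p)) by (split; assumption).
      (* Test with [Bot]: if no [y] above [x] forced [C], the theory would derive [C --> Dia Bot],
         hence [B --> Dia Bot], which fails at [x] since [Dia Bot] is never forced. *)
      specialize (h (exist _ _ hq) (ex_intro _ (i, x) eq_refl) Bot).
      rewrite !derives_step in h.
      apply NNPP; intros hn.
      assert (hD : force F x (Dia Bot)).
      { apply (fun hh => h hh x hx hB).
        intros y hy hC; exfalso; apply hn; now exists y. }
      apply force_Dia in hD; destruct hD as (? & _ & []).
    + intros h [q hq] [[i x] e] E; cbn in e; subst q.
      rewrite !derives_step; intros hC y hy hB.
      (* Pass from [y] to some [z] above it forcing [C]. By [ext_M], [y] sees whatever [z] sees, so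
         [Dia E] moves back from [z] to [y]. *)
      destruct (h i y (ext_refl_r _ _ _ _ _ hy) hB) as (z & hz & hzC).
      specialize (hC z (ext_trans _ _ _ _ _ _ hy hz) hzC).
      apply force_Dia in hC; destruct hC as (t & ht & hE).
      apply force_Dia; exists t; split; [eapply ext_M; eassumption | exact hE].
Qed.

Lemma path_model_provability F r : provability_model (path_model F r).
Proof.
  split.
  - intros [q hq] [[p hp] [[i x] e]]; cbn in e; subst q; split.
    + now left.
    + intros A hA; apply derives_step; intros; now apply force_tautology.
  - intros [q hq] _ A _ [[p hp] [[[i x] e] h]]; cbn in e; subst q.
    apply derives_step; intros y hy.
    (* Each [y] above [x] is the end of a sibling path over the same [p], and the hypothesis gives
       [A] at all siblings. *)
    assert (hv : is_path F r ((i, y) :: p)).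
    { split; [eapply ext_refl_r; exact hy | exact hp]. }
    apply (sat_force F r A (exist _ _ hv)), h, t_step.
    now exists (i, y).
Qed.

Lemma path_model_tree F r : tree (path_model F r).
Proof.
  intros [p hp] [p' hp'] [q hq] [e h] [e' h']; left; cbn in *.
  rewrite h in h'; injection h' as _ ->; f_equal; apply proof_irrelevance.
Qed.

Lemma path_model_necessitation F r : with_necessitation (path_model F r).
Proof.
  intros [q hq] [p [[i x] e]]; cbn in e; subst q; left; now right.
Qed.

Lemma path_step_rank F r i x p :
  is_path F r ((i, x) :: p) -> rank F x < rank F (path_end F r p).
Proof. intros [h _]; apply rel_rank; now exists i. Qed.

Lemma path_model_wf F r : conversely_well_founded (path_model F r).
Proof.
  intros [f hf].
  set (rk := fun p : world (path_model F r) => rank F (path_end F r (proj1_sig p))).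
  assert (hlt : forall n, rk (f (S n)) < rk (f n)).
  { intros n; unfold rk; destruct (hf n) as [[i x] e].
    destruct (f (S n)) as [q hq], (f n) as [p hp]; cbn in *; subst q.
    eapply path_step_rank; exact hq. }
  assert (hle : forall n, n + rk (f n) <= rk (f 0)).
  { induction n as [| n IH]; [lia | specialize (hlt n); lia]. }
  specialize (hle (S (rk (f 0)))); lia.
Qed.

(** * Finiteness of the path model *)

Fixpoint words {T : Type} (l : list T) (n : nat) : list (list T) :=
  match n with
  | 0 => [[]]
  | S n => [] :: flat_map (fun w => map (fun a => a :: w) l) (words l n)
  end.

Lemma in_words {T : Type} (l : list T) n w :
  length w <= n -> (forall a, In a w -> In a l) -> In w (words l n).
Proof.
  revert w; induction n as [| n IH]; intros [| a w] hn hl; cbn in *; try lia; auto.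
  right; apply in_flat_map; exists w; split.
  - apply IH; [lia | auto].
  - apply (in_map (fun a => a :: w)); auto.
Qed.

Lemma Finite_sig {T : Type} (P : T -> Prop) (l : list T) :
  (forall a, P a -> In a l) -> Finite {a | P a}.
Proof.
  intros hl.
  (* Stated without assuming that [l] covers [P], so that induction on [l] applies. *)
  assert (h : exists l', forall s : {a | P a}, In (proj1_sig s) l -> In s l').
  { clear hl; induction l as [| a l [l' IH]].
    - now exists [].
    - destruct (classic (P a)) as [ha | ha].
      + exists (exist _ a ha :: l'); intros [b hb] [e | hs].
        * cbn in e; subst b; left; f_equal; apply proof_irrelevance.
        * right; now apply IH.
      + exists l'; intros [b hb] [e | hs]; [cbn in e; now subst b | now apply IH]. }
  destruct h as [l' h]; exists l'; intros s; apply h, hl, proj2_sig.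
Qed.

Lemma path_model_finite F r : finite_model (path_model F r).
Proof.
  (* Each step costs rank. This bounds both the length of a path and the rank of every node a step
     starts from. *)
  assert (hr : forall p, is_path F r p ->
    length p + rank F (path_end F r p) <= rank F r).
  { induction p as [| [i x] p IH]; intros hp; [reflexivity |].
    specialize (IH (proj2 hp)).
    pose proof (path_step_rank _ _ _ _ _ hp) as hlt; cbn in *; lia. }
  apply (Finite_sig _ (words (points F (rank F r)) (rank F r))).
  intros p hp; apply in_words.
  - specialize (hr p hp); lia.
  - induction p as [| [i x] p IH]; [easy |]; intros a [<- | ha].
    + eapply ext_points; [| exact (proj1 hp)].
      specialize (hr p (proj2 hp)); lia.
    + apply IH; [exact (proj2 hp) | exact ha].
Qed.

(** * The canonical frame of a formula *)

Fixpoint sub (A : form) : list form :=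
  A :: match A with
       | B --> C => sub B ++ sub C
       | B |> C => sub B ++ sub C
       | _ => []
       end.

Lemma in_sub A : In A (sub A).
Proof. destruct A; now left. Qed.

(** [Bot] is included because [Bot]-critical nodes are exactly the nodes seen. *)
Definition consequents (A : form) : list form :=
  Bot :: flat_map (fun F => match F with _ |> C => [C] | _ => [] end) (sub A).

Lemma in_consequents A B C : In (B |> C) (sub A) -> In C (consequents A).
Proof.
  intros h; right; apply in_flat_map; exists (B |> C); split; [exact h | now left].
Qed.

(** All sign patterns over [D], inconsistent ones included; [is_node] imposes consistency. *)
Fixpoint types (D : list form) : list form :=
  match D with
  | [] => [Neg Bot]
  | F :: D => map (And F) (types D) ++ map (And (Neg F)) (types D)
  end.

Lemma types_decide D t F :
  In t (types D) -> In F D -> |-- t --> F \/ |-- t --> Neg F.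
Proof.
  revert t; induction D as [| G D IH]; intros t ht hF; [destruct hF |].
  cbn in ht; apply in_app_or in ht.
  destruct ht as [ht | ht]; apply in_map_iff in ht; destruct ht as (s & <- & hs).
  - destruct hF as [-> | hF].
    + left; apply ILM_taut; prove_tautology.
    + destruct (IH s hs hF) as [h | h]; [left | right];
        refine (ILM_taut1 _ _ h _); prove_tautology.
  - destruct hF as [-> | hF].
    + right; apply ILM_taut; prove_tautology.
    + destruct (IH s hs hF) as [h | h]; [left | right];
        refine (ILM_taut1 _ _ h _); prove_tautology.
Qed.

(** Case distinction on every formula of [D]. The predicate [Q] is abstract so as to serve both for
    [|>] with a fixed right-hand side and for derivability of a fixed consequence. *)
Lemma types_cover (Q : form -> Prop)
  (mono : forall G H, |-- H --> G -> Q G -> Q H)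
  (split : forall G F, Q (And G F) -> Q (And G (Neg F)) -> Q G) D G :
  (forall t, In t (types D) -> Q (And G t)) -> Q G.
Proof.
  revert G; induction D as [| F D IH]; cbn; intros G h.
  - apply (mono (And G (Neg Bot))); [| apply h; now left].
    apply ILM_taut; prove_tautology.
  - apply (split G F); apply IH; intros t ht.
    + apply (mono (And G (And F t))); [apply ILM_taut; prove_tautology |].
      apply h, in_or_app; left; now apply in_map.
    + apply (mono (And G (And (Neg F) t))); [apply ILM_taut; prove_tautology |].
      apply h, in_or_app; right; now apply in_map.
Qed.

Lemma types_witness T D G C :
  ~ |-- T --> G |> C ->
  exists t, In t (types D) /\ ~ |-- T --> t |> C /\
    forall F, In F D -> |-- G --> F -> |-- t --> F.
Proof.
  intros h; apply NNPP; intros hn; apply h.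
  apply (types_cover (fun G => |-- T --> G |> C)) with (D := D).
  - intros G' H hH; apply rhd_trans, rhd_imp_under, hH.
  - intros G' F; apply rhd_split.
  - intros t ht; apply NNPP; intros ht'; apply hn; exists t; repeat split.
    + exact ht.
    + intros h'; apply ht', rhd_trans with t; [| exact h'].
      apply rhd_imp_under, ILM_taut; prove_tautology.
    (* If [t] refuted a consequence of [G], then [And G t] would be inconsistent, and [And G t |> C]
       would hold trivially. *)
    + intros F hF hGF; destruct (types_decide _ _ _ ht hF) as [h' | h']; [exact h' |].
      exfalso; apply ht', rhd_imp_under.
      refine (ILM_taut2 _ _ _ hGF h' _); prove_tautology.
Qed.

Lemma not_rhd_consistent T t C : ~ |-- T --> t |> C -> ~ |-- Neg t.
Proof.
  intros hn h; apply hn, rhd_imp_under; refine (ILM_taut1 _ _ h _); prove_tautology.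
Qed.

(** If [t] refuted [Box c], then [Box (Box c)], which [T] proves by axiom 4, would yield
    [Box (Neg t)] and hence [t |> C]. *)
Lemma not_rhd_preserves_box T D t C c :
  In t (types D) -> ~ |-- T --> t |> C -> In (Box c) D ->
  |-- T --> Box c -> |-- t --> Box c.
Proof.
  intros ht hn hc h.
  destruct (types_decide _ _ _ ht hc) as [h' | h']; [exact h' | exfalso; apply hn].
  apply box_neg_rhd.
  refine (ILM_taut3 _ _ _ _ h (GL_axiom_ILM _ (GL_4 c)) (box_mono (Box c) (Neg t) _) _).
  - refine (ILM_taut1 _ _ h' _); prove_tautology.
  - prove_tautology.
Qed.

(* A type over level [S k] knows which types over level [k] it sees, and from
   which of them it cannot reach a given consequent. *)
Fixpoint closure (A : form) (k : nat) : list form :=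
  match k with
  | 0 => sub A ++
      flat_map (fun F => match F with B |> _ => [Box (Neg B)] | _ => [] end) (sub A)
  | S k => closure A k ++
      map (fun t => Box (Neg t)) (types (closure A k)) ++
      flat_map (fun E => map (fun t => t |> E) (types (closure A k))) (consequents A)
  end.

Lemma closure_le A j k F : j <= k -> In F (closure A j) -> In F (closure A k).
Proof.
  induction 1; [auto | intros; apply in_or_app; left; auto].
Qed.

Lemma sub_closure A k F : In F (sub A) -> In F (closure A k).
Proof.
  intros h; apply closure_le with 0; [lia |]; apply in_or_app; now left.
Qed.

Lemma box_antecedent_closure A k B C :
  In (B |> C) (sub A) -> In (Box (Neg B)) (closure A k).
Proof.
  intros h; apply closure_le with 0; [lia |]; apply in_or_app; right.
  apply in_flat_map; exists (B |> C); split; [exact h | now left].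
Qed.

Lemma box_type_closure A j k t :
  j < k -> In t (types (closure A j)) -> In (Box (Neg t)) (closure A k).
Proof.
  intros hjk ht; apply closure_le with (S j); [exact hjk |].
  cbn; apply in_or_app; right; apply in_or_app; left.
  now apply (in_map (fun t => Box (Neg t))).
Qed.

(** * Counting the boxes missing from a type *)

Definition unbox (D : list form) : list form :=
  flat_map (fun F => match F with (c --> Bot) |> Bot => [c] | _ => [] end) D.

Lemma in_unbox D c : In (Box c) D <-> In c (unbox D).
Proof.
  unfold unbox; rewrite in_flat_map; split.
  - intros h; exists (Box c); split; [exact h | now left].
  - intros (F & hF & hc).
    destruct F as [| | | [| | B [] |] []]; cbn in hc; try contradiction.
    destruct hc as [-> | []]; exact hF.
Qed.

Definition count_not (P : form -> Prop) (l : list form) : nat :=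
  length (filter (fun c => if excluded_middle_informative (P c) then false else true) l).

Lemma count_not_le (P Q : form -> Prop) l :
  (forall c, In c l -> P c -> Q c) -> count_not Q l <= count_not P l.
Proof.
  unfold count_not; induction l as [| c l IH]; cbn; intros h; [lia |].
  specialize (IH (fun d hd => h d (or_intror hd))).
  specialize (h c (or_introl eq_refl)).
  destruct (excluded_middle_informative (P c)),
    (excluded_middle_informative (Q c)); cbn; intuition lia.
Qed.

Lemma count_not_lt (P Q : form -> Prop) l c0 :
  (forall c, In c l -> P c -> Q c) -> In c0 l -> ~ P c0 -> Q c0 ->
  count_not Q l < count_not P l.
Proof.
  intros h h0 hP hQ; induction l as [| c l IH]; [destruct h0 |].
  pose proof (count_not_le P Q l (fun d hd => h d (or_intror hd))) as hle.
  specialize (IH (fun d hd => h d (or_intror hd))).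
  specialize (h c (or_introl eq_refl)).
  unfold count_not in *; cbn.
  destruct (excluded_middle_informative (P c)),
    (excluded_middle_informative (Q c)); cbn;
    destruct h0 as [<- | h0]; try contradiction; intuition lia.
Qed.

(** Boxes are counted in the closure of rank 0 whatever the rank of [t], so that types of different
    ranks can be compared. *)
Definition missing (A t : form) : nat :=
  count_not (fun c => |-- t --> Box c) (unbox (closure A 0)).

(** The bound on [missing] leaves enough rank for witnesses: each witness to a refuted [|>] goes
    down one rank and gains a box. *)
Definition is_node (A : form) (w : nat * form) : Prop :=
  In (snd w) (types (closure A (fst w))) /\
  missing A (snd w) <= fst w /\ ~ |-- Neg (snd w).

Lemma node_decide A w F :
  is_node A w -> In F (closure A (fst w)) ->
  ~ |-- snd w --> F -> |-- snd w --> Neg F.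
Proof.
  intros (h & _ & _) hF hn; destruct (types_decide _ _ _ h hF); tauto.
Qed.

Lemma node_consistent A w F :
  is_node A w -> |-- snd w --> F -> ~ |-- snd w --> Neg F.
Proof.
  intros (_ & _ & h) h1 h2; apply h.
  refine (ILM_taut2 _ _ _ h1 h2 _); prove_tautology.
Qed.

(** * Critical nodes and the canonical relations *)

Definition critical (A : form) (u : nat * form) (E : form) (v : nat * form) : Prop :=
  In E (consequents A) /\ is_node A v /\ fst v < fst u /\
  ~ |-- snd u --> snd v |> E.

Definition sees (A : form) (u v : nat * form) : Prop := exists E, critical A u E v.

Lemma sees_box A u v :
  sees A u v <-> is_node A v /\ fst v < fst u /\ ~ |-- snd u --> Box (Neg (snd v)).
Proof.
  split.
  - intros (E & _ & hv & hlt & hn); repeat split; try apply hv; try exact hlt.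
    intros h; apply hn, box_neg_rhd, h.
  - intros (hv & hlt & hn); exists Bot; repeat split; try apply hv; try exact hlt.
    + now left.
    + intros h; apply hn, rhd_bot_box, h.
Qed.

(** Since [w] has lower rank, [v] decides [Box (Neg (snd w))] and so proves [Dia (snd w)]. By J5,
    [snd w |> E] would then give [snd v |> E]. *)
Lemma critical_sees A u E v w : critical A u E v -> sees A v w -> critical A u E w.
Proof.
  intros (hE & hv & hlt & hn) hw; apply sees_box in hw.
  destruct hw as (hw & hlt' & hn'); repeat split; try apply hw; try exact hE; [lia |].
  intros h; apply hn.
  apply rhd_trans with (Dia (snd w)).
  - apply rhd_imp_under, (node_decide A v); [exact hv | | exact hn'].
    apply box_type_closure with (fst w); [exact hlt' | apply hw].
  - apply rhd_trans with (snd w); [apply dia_rhd | exact h].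
Qed.

Definition ext_critical A u E x y : Prop :=
  critical A u E x /\ critical A u E y /\ forall z, sees A y z -> sees A x z.

Lemma sees_ext A w x : (exists E, ext_critical A w E x x) <-> sees A w x.
Proof.
  split.
  - intros (E & h & _); now exists E.
  - intros (E & h); exists E; repeat split; try apply h; auto.
Qed.

Fixpoint nodes_upto (A : form) (n : nat) : list (nat * form) :=
  match n with
  | 0 => []
  | S n => map (pair n) (types (closure A n)) ++ nodes_upto A n
  end.

Lemma in_nodes_upto A n w : is_node A w -> fst w < n -> In w (nodes_upto A n).
Proof.
  destruct w as [k t]; intros [h _]; cbn in *.
  induction 1 as [| n _ IH]; cbn; apply in_or_app.
  - left; now apply in_map.
  - now right.
Qed.

Lemma ext_critical_rank A w x :
  (exists E, ext_critical A w E x x) -> fst x < fst w.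
Proof. intros h; apply sees_ext, sees_box in h; apply h. Qed.

Lemma ext_critical_points A n w E x :
  fst w <= n -> ext_critical A w E x x ->
  In (E, x) (list_prod (consequents A) (nodes_upto A n)).
Proof.
  intros hn [(hE & hx & hlt & _) _]; apply in_prod; [exact hE |].
  apply in_nodes_upto; [exact hx | lia].
Qed.

Lemma ext_critical_trans A w E x y z :
  ext_critical A w E x y -> ext_critical A w E y z -> ext_critical A w E x z.
Proof. unfold ext_critical; intuition. Qed.

(** Two uses of [critical_sees]: criticality passes from [y] to [z], and accessibility is
    transitive, so [z] sees no more than [y]. *)
Lemma ext_critical_sees A w E x y z :
  ext_critical A w E x y -> (exists E', ext_critical A y E' z z) ->
  ext_critical A w E x z.
Proof.
  intros (hx & hy & h) hz; apply sees_ext in hz; split; [exact hx | split].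
  - eapply critical_sees; eassumption.
  - intros v hv; apply h; destruct hz as [E' hz]; exists E'.
    eapply critical_sees; eassumption.
Qed.

(** Kept transparent, since the truth lemma computes with the fields. *)
Definition canonical_frame (A : form) : frame.
Proof.
  refine {|
    node := nat * form;
    label := form;
    ext := ext_critical A;
    atom w p := |-- snd w --> Var p;
    rank := fst;
    points n := list_prod (consequents A) (nodes_upto A n);
    ext_rel := ext_critical_sees A;
    ext_trans := ext_critical_trans A;
    rel_rank := ext_critical_rank A;
    ext_points := ext_critical_points A
  |}.
  - intros w E x y (h & _); split; auto.
  - intros w E x y (_ & h & _); split; auto.
  - intros w E x y z (_ & _ & h) hz; apply sees_ext, h, sees_ext, hz.
Defined.

(** * Witnesses and the truth lemma *)

Lemma not_rhd_witness A u B C :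
  is_node A u -> In (B |> C) (sub A) -> In B (sub A) -> ~ |-- snd u --> B |> C ->
  exists v, critical A u C v /\ |-- snd v --> B.
Proof.
  intros hu hBC hB hn.
  assert (hbox : ~ |-- snd u --> Box (Neg B)).
  { intros h; apply hn, box_neg_rhd, h. }
  assert (hc0 : In (Neg B) (unbox (closure A 0))).
  { apply in_unbox, box_antecedent_closure with C, hBC. }
  destruct u as [k t]; destruct hu as (ht & hm & hc); cbn [fst snd] in *.
  assert (hmiss : forall z, (forall c, In c (unbox (closure A 0)) ->
      |-- t --> Box c -> |-- z --> Box c) -> |-- z --> Box (Neg B) ->
      missing A z < missing A t).
  { intros z hz hzB; eapply count_not_lt; eassumption. }
  destruct k as [| k].
  (* Rank 0 is impossible: [Bot] proves every box, so [missing A Bot] would be smaller than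
     [missing A t], which is 0. *)
  { enough (missing A Bot < missing A t) by lia.
    apply hmiss; intros; apply ILM_taut; prove_tautology. }
  (* By [rhd_lob], [B] may be strengthened by [Box (Neg B)]. By [hbox] this box is new, so [missing]
     drops and rank [k] suffices. *)
  destruct (types_witness t (closure A k) (And B (Box (Neg B))) C) as (z & hz & hzC & hG).
  { intros h; apply hn; eapply rhd_trans; [apply rhd_lob | exact h]. }
  exists (k, z); cbn; split.
  - split; [eapply in_consequents, hBC |]; split; [| split; [cbn; lia | exact hzC]].
    split; [exact hz | split; [| eapply not_rhd_consistent, hzC]]; cbn [fst snd].
    enough (missing A z < missing A t) by lia.
    apply hmiss.
    + intros c hc'; apply in_unbox in hc'.
      eapply not_rhd_preserves_box; [exact hz | exact hzC |].
      eapply closure_le; [| exact hc']; lia.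
    + apply hG; [apply box_antecedent_closure with C, hBC |].
      apply ILM_taut; prove_tautology.
  - apply hG; [apply sub_closure, hB | apply ILM_taut; prove_tautology].
Qed.

Lemma rhd_witness A u E v B C :
  critical A u E v -> In C (sub A) -> |-- snd u --> B |> C -> |-- snd v --> B ->
  exists w, ext_critical A u E v w /\ |-- snd w --> C.
Proof.
  intros hv hC hBC hB; pose proof hv as (hE & hnode & hlt & hn).
  destruct v as [m z]; destruct hnode as (hz & hm & hz0); cbn [fst snd] in *.
  (* All boxes proved by [z] in the closure of its own rank: those of rank 0 bound [missing], and
     the boxes [Box (Neg t)] for types of lower rank control which nodes are seen. *)
  set (l := filter
    (fun c => if excluded_middle_informative (|-- z --> Box c) then true else false)
    (unbox (closure A m))).
  assert (hl : forall c, In c l <-> In (Box c) (closure A m) /\ |-- z --> Box c).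
  { intros c; unfold l; rewrite filter_In, in_unbox.
    destruct excluded_middle_informative; intuition congruence. }
  pose (K := conjunction (map Box l)).
  assert (hK : |-- z --> K).
  { apply conj_intro; intros F hF; apply in_map_iff in hF.
    destruct hF as (c & <- & hc); now apply hl. }
  assert (hKbox : forall c, In c l -> |-- K --> Box c).
  { intros c hc; apply conj_elim, in_map, hc. }
  assert (hM : |-- snd u --> And K B |> And K C) by apply rhd_boxes, hBC.
  clearbody K.
  destruct (types_witness (snd u) (closure A m) (And K C) E) as (y & hy & hyE & hG).
  { intros h; apply hn, rhd_trans with (And K B).
    - apply rhd_imp_under; refine (ILM_taut2 _ _ _ hK hB _); prove_tautology.
    - eapply rhd_trans; [exact hM | exact h]. }
  assert (hbox : forall c, In (Box c) (closure A m) ->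
    |-- z --> Box c -> |-- y --> Box c).
  { intros c hc hzc; apply hG; [exact hc |].
    refine (ILM_taut1 _ _ (hKbox c _) _); [now apply hl | prove_tautology]. }
  exists (m, y); cbn; split.
  - split; [exact hv | split].
    + split; [exact hE |]; split; [| split; [exact hlt | exact hyE]].
      split; [exact hy | split; [| eapply not_rhd_consistent, hyE]]; cbn [fst snd].
      eapply Nat.le_trans; [| exact hm].
      apply count_not_le; intros c hc; apply in_unbox in hc.
      apply hbox; eapply closure_le; [| exact hc]; lia.
    + intros x hx; apply sees_box in hx; destruct hx as (hx & hxlt & hxn).
      apply sees_box; split; [exact hx | split; [exact hxlt |]].
      intros h; apply hxn, hbox; [| exact h].
      eapply box_type_closure; [exact hxlt | apply hx].
  - apply hG; [apply sub_closure, hC | apply ILM_taut; prove_tautology].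
Qed.

Lemma truth_lemma A B w :
  incl (sub B) (sub A) -> is_node A w ->
  (force (canonical_frame A) w B <-> |-- snd w --> B).
Proof.
  revert w; induction B as [p | | B IHB C IHC | B IHB C IHC]; intros w hs hw.
  - reflexivity.
  - split; [intros [] |]; intros h.
    apply (node_consistent A w Bot hw h), ILM_taut; prove_tautology.
  - assert (hB : incl (sub B) (sub A)).
    { intros F hF; apply hs; right; apply in_or_app; now left. }
    assert (hC : incl (sub C) (sub A)).
    { intros F hF; apply hs; right; apply in_or_app; now right. }
    cbn [force]; rewrite (IHB w hB hw), (IHC w hC hw); split; intros h.
    + destruct (classic (|-- snd w --> B)) as [hwB | hwB].
      * refine (ILM_taut1 _ _ (h hwB) _); prove_tautology.
      * apply (node_decide A w) in hwB; [| exact hw | apply sub_closure, hB, in_sub].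
        refine (ILM_taut1 _ _ hwB _); prove_tautology.
    + intros hwB; refine (ILM_taut2 _ _ _ h hwB _); prove_tautology.
  - assert (hB : incl (sub B) (sub A)).
    { intros F hF; apply hs; right; apply in_or_app; now left. }
    assert (hC : incl (sub C) (sub A)).
    { intros F hF; apply hs; right; apply in_or_app; now right. }
    split; intros h.
    + apply NNPP; intros hn.
      destruct (not_rhd_witness A w B C hw) as (v & hv & hvB);
        [apply hs, in_sub | apply hB, in_sub | exact hn |].
      (* The label [C] itself is used: a [C]-critical node cannot prove [C]. *)
      destruct (h C v) as (y & (_ & (_ & hy & _ & hyn) & _) & hyC).
      * repeat split; try apply hv; auto.
      * apply IHB; [exact hB | apply hv | exact hvB].
      * apply IHC in hyC; [| exact hC | exact hy].
        apply hyn, rhd_imp_under, hyC.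
    + intros E x [hx _] hxB.
      apply IHB in hxB; [| exact hB | apply hx].
      destruct (rhd_witness A w E x B C hx) as (y & hy & hyC);
        [apply hC, in_sub | exact h | exact hxB |].
      exists y; split; [exact hy |].
      apply IHC; [exact hC | apply hy | exact hyC].
Qed.

Lemma root_node A :
  ~ |-- A -> exists w, is_node A w /\ ~ |-- snd w --> A.
Proof.
  intros hn.
  (* With all boxes counted in the rank, every type satisfies the bound on [missing]. *)
  set (N := length (unbox (closure A 0))).
  apply NNPP; intros hno; apply hn.
  enough (h : |-- Neg Bot --> A) by (refine (ILM_taut1 _ _ h _); prove_tautology).
  apply (types_cover (fun G => |-- G --> A)) with (D := closure A N).
  - intros G H h1 h2; refine (ILM_taut2 _ _ _ h1 h2 _); prove_tautology.
  - intros G F h1 h2; refine (ILM_taut2 _ _ _ h1 h2 _); prove_tautology.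
  - intros t ht; enough (h : |-- t --> A) by
      (refine (ILM_taut1 _ _ h _); prove_tautology).
    apply NNPP; intros hA; apply hno; exists (N, t); split; [| exact hA].
    split; [exact ht | split].
    + apply filter_length_le.
    + intros h; apply hA; refine (ILM_taut1 _ _ h _); prove_tautology.
Qed.

Theorem theorem5p9 (A : form)
  (hA : forall P : premodel,
      provability_model P -> finite_model P -> tree P ->
      conversely_well_founded P -> with_necessitation P ->
      forall w : world P, sat P w A) :
  derives ILM A.
Proof.
  apply NNPP; intros hn.
  destruct (root_node A hn) as (r & hr & hrA); apply hrA.
  set (F := canonical_frame A).
  apply (truth_lemma A A r (incl_refl _) hr).
  (* The empty path is the root, with end [r]. *)
  apply (sat_force F r A (exist _ [] I)), hA.
  - apply path_model_provability.
  - apply path_model_finite.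
  - apply path_model_tree.
  - apply path_model_wf.
  - apply path_model_necessitation.
Qed.
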